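(* Let $\mathrm{X}_1\subset\mathbb{R}^{n_1}$ and $\mathrm{X}_2\subset\mathbb{R}^{n_2}$ be nonempty, convex, and compact. Let $J_1:\mathrm{X}_1\times\mathrm{X}_2\to\mathbb{R}$ be continuous on $\mathrm{X}_1\times\mathrm{X}_2$ and such that, for every fixed $x_2\in\mathrm{X}_2$, the function $J_1(\cdot,x_2)$ is convex on $\mathrm{X}_1$. Let $\mathrm{BR}_2:\mathrm{X}_1\rightrightarrows\mathrm{X}_2$ be the best-response correspondence of Player 2, and suppose that for every $x_1\in\mathrm{X}_1$ the set $\mathrm{BR}_2(x_1)\subseteq\mathrm{X}_2$ is nonempty, convex, and compact, and that $\mathrm{BR}_2$ is upper hemicontinuous. Then the asymmetric-information two-player game defined by $(\mathrm{X}_1,\mathrm{X}_2,J_1,\mathrm{BR}_2)$ admits at least one Nash equilibrium.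
   Context: The asymmetric-information two-player game: Player 1 chooses $x_1\in\mathrm{X}_1$ to minimize $J_1(x_1,x_2)$ over $x_1\in\mathrm{X}_1$, while Player 2 simultaneously reacts with $x_2\in\mathrm{BR}_2(x_1)$. Here $\mathrm{BR}_2(x_1)=\arg\min_{x_2\in\mathrm{X}_2}J_2(x_1,x_2)$ for some function $J_2:\mathrm{X}_1\times\mathrm{X}_2\to\mathbb{R}$ which need not be known; Player 2 enters only through the set-valued map $\mathrm{BR}_2$, and no assumptions are made on $J_2$ beyond those stated on $\mathrm{BR}_2$. A pair $(x_1^\star,x_2^\star)\in\mathrm{X}_1\times\mathrm{X}_2$ is a Nash equilibrium of this game if $x_1^\star\in\arg\min_{x_1\in\mathrm{X}_1}J_1(x_1,x_2^\star)$ and $x_2^\star\in\mathrm{BR}_2(x_1^\star)$. *)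

(* Defs.v *)
From mathcomp Require Export all_boot all_order all_algebra.
From mathcomp Require Export all_classical all_reals all_analysis.
Export Order.TTheory GRing.Theory Num.Theory.
Export numFieldNormedType.Exports.

Set Implicit Arguments.
Unset Strict Implicit.
Unset Printing Implicit Defensive.

Local Open Scope classical_set_scope.
Local Open Scope ring_scope.

Definition argmin (R : numDomainType) (T : Type) (A : set T) (f : T -> R) :
    set T :=
  [set x | A x /\ forall y, A y -> f x <= f y].

(* Functions and correspondences on a subset [A] of a space [T] are total on
   [T], and only their values on [A] are used. Open sets of [U] stand for
   relatively open sets of the codomain: when the values of [F] on [A] lie in
   [B], [F x `<=` V] and [F x `<=` V `&` B] agree for [x] in [A]. *)
Definition upper_hemicontinuous_on (T U : topologicalType) (A : set T)
    (F : T -> set U) : Prop :=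
  forall x, A x -> forall V : set U, open V -> F x `<=` V ->
    \forall y \near within A (nbhs x), F y `<=` V.

Definition is_best_response (R : numDomainType) (T1 T2 : Type)
    (X1 : set T1) (X2 : set T2) (J2 : T1 * T2 -> R) (BR2 : T1 -> set T2) :
    Prop :=
  forall x1, X1 x1 -> BR2 x1 = argmin X2 (fun x2 => J2 (x1, x2)).

Definition nash_equilibrium (R : numDomainType) (T1 T2 : Type)
    (X1 : set T1) (X2 : set T2) (J1 : T1 * T2 -> R) (BR2 : T1 -> set T2)
    (x : T1 * T2) : Prop :=
  [/\ (X1 `*` X2) x,
      argmin X1 (fun x1 => J1 (x1, x.2)) x.1 &
      BR2 x.1 x.2].

(* Main.v *)
(* Kakutani's theorem is applied to the correspondence
   (x1, x2) |-> argmin J1(., x2) * BR2(x1) on X1 * X2, following McLennan and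
   Tourky. Pick an e-net x_1, .., x_n of the domain K and y_i in F(x_i). If some
   r in the simplex satisfies |x_i - z| <= e for all i with r_i > 0, where
   z = \sum_i r_i y_i, then z is almost a convex combination of points of
   F(z), and e -> 0 gives a fixed point. Such an r exists by the dual KKM lemma:
   if closed sets G_i cover the simplex, then some r lies in G_i whenever
   r_i > 0; take for G_i the set of all r with |x_i - z| <= e. The lemma is a
   limit of its version for a fine grid, which is Scarf's combinatorial lemma on
   a finite set with several linear orders; that one is proved by the parity
   argument for Sperner's lemma, with order-theoretic rooms and doors in place
   of simplices and facets, so that no triangulation is needed. *)

Require Import Defs.
From mathcomp Require Import finmap ring lra.

Set Implicit Arguments.
Unset Strict Implicit.
Unset Printing Implicit Defensive.

(** * Scarf's lemma *)

Section Combinatorics.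
Import mathcomp.boot.fintype mathcomp.boot.finset.

(** A map onto a set with one element fewer has a single fibre of size two, and only deleting one of
    its two points keeps the image. It serves for orders that share a least element and for vertices
    that share a colour. *)
Lemma collapsed_pair (aT rT : finType) (f : aT -> rT) (A : {set aT}) (B : {set rT}) :
  f @: A = B -> #|A| = #|B|.+1 ->
  exists i j, [/\ i \in A, j \in A, i != j, f i = f j &
    forall k, k \in A -> (f @: (A :\ k) == B) = (k \in [set i; j])].
Proof.
move=> fAB cAB.
have cardA k : k \in A -> #|A :\ k| = #|B|.
  by move=> kA; move: cAB; rewrite (cardsD1 k A) kA => -[].
have ninj : ~~ dinjectiveb f (mem A).
  apply/negP => /dinjectiveP finj; have := card_in_imset finj.
  by rewrite fAB cAB => /n_Sn.
have /dinjectivePn [i iA [j /andP[/= nji jA] fij]] := ninj.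
exists i, j; split=> //; first by rewrite eq_sym.
have coll k l : k \in A -> l \in A -> k != l -> f k = f l -> f @: (A :\ k) = B.
  move=> kA lA nkl fkl; apply/eqP; rewrite eqEsubset; apply/andP; split.
    by rewrite -fAB imsetS // subD1set.
  apply/subsetP=> y; rewrite -fAB => /imsetP[x xA ->].
  have [->|nxk] := eqVneq x k.
    by rewrite fkl imset_f // !inE lA andbT eq_sym.
  by rewrite imset_f // !inE nxk.
have fi : f @: (A :\ i) = B by apply: (coll i j) => //; rewrite eq_sym.
have fj : f @: (A :\ j) = B by apply: (coll j i) => //.
have inj k : k \in A -> f @: (A :\ k) = B -> {in A :\ k &, injective f}.
  by move=> kA fk; apply/imset_injP; rewrite fk cardA.
move=> k kA; rewrite !inE; apply/eqP/idP => [fk|/pred2P[]->//].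
apply/negPn/negP; rewrite negb_or => /andP[nki nkj].
move/negP: nji; apply; apply/eqP.
by apply: (inj k) => //; rewrite !inE eq_sym ?nki ?nkj ?iA ?jA //.
Qed.

(** Dominance in Scarf's sense: no [y] lies strictly above the minima of [S] in all orders at once.
    Dominant sets stand in for the faces of a triangulation. *)
Definition dominant (X I : finType) (u : I -> X -> nat) (S : {set X}) : bool :=
  [forall y, exists i, forall x in S, u i y <= u i x].

Lemma dominantP (X I : finType) (u : I -> X -> nat) (S : {set X}) :
  reflect (forall y, exists i, forall x, x \in S -> u i y <= u i x)
          (dominant u S).
Proof.
apply: (iffP forallP) => dS y.
  by have /existsP[i /forall_inP Si] := dS y; exists i.
by have [i Si] := dS y; apply/existsP; exists i; apply/forall_inP.
Qed.

Lemma dominantS (X I : finType) (u : I -> X -> nat) (A B : {set X}) :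
  A \subset B -> dominant u B -> dominant u A.
Proof.
move=> /subsetP AB /dominantP dB; apply/dominantP => y.
by have [i Bi] := dB y; exists i => x /AB; apply: Bi.
Qed.

Definition min_selector (X I : finType) (u : I -> X -> nat) (S : {set X}) (m : I -> X) :=
  forall i, m i \in S /\ forall x, x \in S -> u i (m i) <= u i x.

Lemma min_selector_exists (X I : finType) (u : I -> X -> nat) (S : {set X}) (s0 : X) :
  s0 \in S -> {m : I -> X | min_selector u S m}.
Proof.
move=> s0S; exists (fun i => [arg min_(x < s0 in S) u i x]) => i.
by case: arg_minnP.
Qed.

(** Dominance tested at a point of [S] itself yields an order in which this point is least, so every
    point of [S] is a minimum. *)
Lemma min_selector_imset (X I : finType) (u : I -> X -> nat) (S : {set X}) (m : I -> X) :
  (forall i, injective (u i)) -> dominant u S -> min_selector u S m ->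
  m @: [set: I] = S.
Proof.
move=> uinj /dominantP dS mS; apply/eqP; rewrite eqEsubset; apply/andP; split.
  by apply/subsetP => _ /imsetP[i _ ->]; case: (mS i).
apply/subsetP => x xS; have [i Si] := dS x.
apply/imsetP; exists i => //; apply: (uinj i); apply/eqP.
by have [miS mmin] := mS i; rewrite eqn_leq Si //= mmin.
Qed.

(* Two orders i, j have the same least element in S; a room S + x is obtained by
   making x the least element for k = i or k = j, and the last hypothesis says
   that there are candidates. Then x must be the k-greatest of them. *)
Lemma card_room_of_door (X I : finType) (u : I -> X -> nat) (S : {set X}) (s0 : X) :
  (forall i, injective (u i)) -> dominant u S -> #|I| = #|S|.+1 -> s0 \in S ->
  (forall m k, min_selector u S m -> exists y, forall l, l != k -> u l (m l) < u l y) ->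
  #|[set x | (x \notin S) && dominant u (x |: S)]| = 2.
Proof.
move=> uinj dS cS s0S Yne.
have [m mS] := min_selector_exists u s0S.
have mmin i x : x \in S -> u i (m i) <= u i x by have [_] := mS i; apply.
have m_in i : m i \in S by have [] := mS i.
have mimS := min_selector_imset uinj dS mS.
have cI : #|[set: I]| = #|S|.+1 by rewrite cardsT.
(* Only [i] and [j] can be given a new least element without some point of [S] ceasing to be a
   minimum. *)
have [i [j [_ _ nij mij freeP]]] := collapsed_pair mimS cI.
have free k : (m @: ([set: I] :\ k) == S) = ((k == i) || (k == j)).
  by rewrite freeP ?inE.
have topY k : {x | (forall l, l != k -> u l (m l) < u l x) &
   forall y, (forall l, l != k -> u l (m l) < u l y) -> u k y <= u k x}.
  pose P y := [forall (l | l != k), u l (m l) < u l y].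
  have /sigW[y0 Py0] : exists y, P y.
    by have [y Py] := Yne m k mS; exists y; apply/forall_inP.
  case: (arg_maxnP (u k) Py0) => x /forall_inP Px maxx; exists x => // y Py.
  by apply: maxx; apply/forall_inP.
have outside k x : (k == i) || (k == j) ->
    (forall l, l != k -> u l (m l) < u l x) -> x \notin S.
  rewrite -free => /eqP fk Px; apply/negP => xS; move: (xS); rewrite -fk.
  case/imsetP=> l; rewrite !inE andbT => /Px + xE.
  by rewrite -xE ltnn.
have below k x : (k == i) || (k == j) ->
    (forall l, l != k -> u l (m l) < u l x) -> u k x < u k (m k).
  move=> kij Px; have xS := outside k x kij Px.
  have /dominantP/(_ x)[l Hl] := dS.
  have [lk|lk] := eqVneq l k; last first.
    by have := Px l lk; rewrite ltnNge Hl.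
  rewrite ltn_neqAle -lk Hl // andbT; apply/eqP => /uinj xE.
  by move: xS; rewrite xE m_in.
have cand k : {x | [/\ (k == i) || (k == j) -> x \notin S /\ dominant u (x |: S),
    (k == i) || (k == j) -> u k x < u k (m k),
    (forall l, l != k -> u l (m l) < u l x) &
    forall y, (forall l, l != k -> u l (m l) < u l y) -> u k y <= u k x]}.
  have [x Px maxx] := topY k; exists x; split=> // kij; last exact: below.
  split; first exact: (outside k).
  (* Either [y] stays below [m l] in some order [l != k], or [y] is a candidate itself and lies
     below the greatest candidate [x] in order [k]. *)
  apply/dominantP => y.
  have [/existsP[l /andP[nlk uly]]|] :=
      boolP [exists l, (l != k) && (u l y <= u l (m l))].
    exists l => z; rewrite !inE => /predU1P[->|zS].
      by rewrite (leq_trans uly) // ltnW // Px.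
    by rewrite (leq_trans uly) // mmin.
  rewrite negb_exists => /forallP Py.
  have {}Py l : l != k -> u l (m l) < u l y.
    by move=> nlk; have := Py l; rewrite nlk /= -ltnNge.
  exists k => z; rewrite !inE => /predU1P[->|zS]; first exact: maxx.
  rewrite (leq_trans (maxx y Py)) // (leq_trans _ (mmin k z zS)) //.
  by rewrite ltnW // below.
have [xi [] ] := cand i; rewrite eqxx /= => /(_ isT)[xiS dxi] /(_ isT) xim Pxi maxi.
have [xj [] ] := cand j; rewrite eqxx orbT /= => /(_ isT)[xjS dxj] /(_ isT) xjm Pxj maxj.
have nx : xi != xj.
  by apply/eqP => xE; have := Pxj i nij; rewrite -xE ltnNge ltnW.
rewrite (_ : [set x | _] = [set xi; xj]); first by rewrite cards2 nx.
apply/setP => x; rewrite !inE; apply/andP/pred2P => [[xS dx]|[]->//].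
(* The minima of a room are pairwise distinct, so [x] is least for a single order [k] and the other
   orders keep their minima in [S]. These still exhaust [S], which forces [k] to be [i] or [j]. *)
have [m' m'S] := min_selector_exists u (setU11 x S).
have m'im := min_selector_imset uinj dx m'S.
have m'inj : injective m'.
  move=> k l kl; have /imset_injP inj : #|m' @: [set: I]| == #|[set: I]|.
    by rewrite m'im cardsU1 xS cI.
  by apply: inj; rewrite ?inE.
have /imsetP[k _ xE] : x \in m' @: [set: I] by rewrite m'im setU11.
have m'S' l : l != k -> m' l = m l.
  move=> nlk; have [] := m'S l; rewrite !inE => /predU1P[m'x|m'lS] m'm_in.
    by case/eqP: nlk; apply: m'inj; rewrite m'x.
  apply: (uinj l); apply/eqP; rewrite eqn_leq m'm_in ?mmin //.
  by rewrite !inE m_in orbT.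
have Px l : l != k -> u l (m l) < u l x.
  move=> nlk; rewrite -m'S' //; have [m'lS m'm_in] := m'S l.
  rewrite ltn_neqAle m'm_in ?setU11 // andbT; apply/eqP => /uinj.
  by rewrite xE => /m'inj /eqP; apply/negP.
have kij : (k == i) || (k == j).
  rewrite -free eqEsubset; apply/andP; split.
    by apply/subsetP => _ /imsetP[l _ ->].
  apply/subsetP => s sS.
  have /imsetP[l _ sE] : s \in m' @: [set: I] by rewrite m'im !inE sS orbT.
  have nlk : l != k.
    by apply/eqP => lk; move: xS; rewrite xE -lk -sE sS.
  by apply/imsetP; exists l; rewrite ?inE ?nlk // -m'S'.
have maxx y : (forall l, l != k -> u l (m l) < u l y) -> u k y <= u k x.
  move=> Py; have /dominantP/(_ y)[l Hl] := dx.
  have [<-|lk] := eqVneq l k; first by rewrite Hl ?setU11.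
  by have := Py l lk; rewrite ltnNge Hl // !inE m_in orbT.
case/orP: kij => /eqP kE; subst k; [left|right];
  by [apply: (uinj i); apply/eqP; rewrite eqn_leq maxx // maxi
     |apply: (uinj j); apply/eqP; rewrite eqn_leq maxx // maxj].
Qed.

(** A room with all colours has one door, obtained by dropping its vertex of colour [i0]. A room
    with exactly the colours other than [i0] has two, by [collapsed_pair], and any other room has
    none. *)
Lemma odd_card_doors (X I : finType) (c : X -> I) (i0 : I) (S : {set X}) :
  #|S| = #|I| ->
  odd #|[set x in S | c @: (S :\ x) == [set~ i0]]| = (c @: S == [set: I]).
Proof.
move=> cS; have cB : #|S| = #|[set~ i0]|.+1.
  by rewrite cardsC1 prednK // -cS cS; apply/card_gt0P; exists i0.
have [cST|ncST] := eqVneq (c @: S) [set: I].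
  have cinj : {in S &, injective c} by apply/imset_injP; rewrite cST cardsT cS.
  have /imsetP[x xS cx] : i0 \in c @: S by rewrite cST inE.
  rewrite (_ : [set x in S | _] = [set x]) ?cards1 //.
  apply/setP => y; rewrite !inE; apply/andP/eqP => [[yS /eqP yB]|->].
    apply/eqP/negPn/negP => nyx; have : c x \in [set~ i0].
      by rewrite -yB imset_f // !inE eq_sym nyx.
    by rewrite !inE -cx eqxx.
  split=> //; apply/eqP/setP => i; rewrite !inE; apply/imsetP/idP.
    case=> z; rewrite !inE => /andP[nzx zS] ->; rewrite cx.
    by apply: contraNneq nzx => /cinj ->.
  have /imsetP[z zS ->] : i \in c @: S by rewrite cST inE.
  move=> nci; exists z; rewrite // !inE zS andbT.
  by apply: contraNneq nci => ->; rewrite cx.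
have [->|/set0Pn[x]] := eqVneq [set x in S | c @: (S :\ x) == [set~ i0]] finset.set0.
  by rewrite cards0.
rewrite inE => /andP[xS /eqP xB].
have cSE : c @: S = c x |: [set~ i0] by rewrite -xB -imsetU1 setD1K.
have cSB : c @: S = [set~ i0].
  have [cx0|cx0] := eqVneq (c x) i0; first by rewrite cSE cx0 setUCr eqxx in ncST.
  by rewrite cSE; apply/setUidPr; rewrite sub1set !inE.
have [i [j [iS jS nij _ freeP]]] := collapsed_pair cSB cB.
rewrite (_ : [set x in S | _] = [set i; j]) ?cards2 ?nij //.
apply/setP => k; rewrite !inE; have [kS|kS] := boolP (k \in S).
  by rewrite freeP // !inE.
by apply/esym/negbTE; apply: contra kS => /pred2P[]->.
Qed.

(** Incidences between doors and rooms are counted twice. Counted by doors, the total is odd because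
    of [S0] alone; counted by rooms, it is even unless some room has all colours. *)
Lemma sperner_parity (X I : finType) (dom : pred {set X}) (c : X -> I)
    (i0 : I) (S0 : {set X}) :
  (forall A B : {set X}, A \subset B -> dom B -> dom A) ->
  dom S0 -> #|I| = #|S0|.+1 -> c @: S0 = [set~ i0] ->
  (forall S, dom S -> #|I| = #|S|.+1 -> c @: S = [set~ i0] ->
    odd #|[set x | (x \notin S) && dom (x |: S)]| = (S == S0)) ->
  exists S, [/\ dom S, #|S| = #|I| & c @: S = [set: I]].
Proof.

move=> domS dS0 cS0 cS0B oddS.
have [/existsP[S /and3P[dS /eqP cS /eqP cST]]|none] :=
    boolP [exists S : {set X}, [&& dom S, #|S| == #|I| & c @: S == [set: I]]].
  by exists S.
pose door (S : {set X}) := [&& dom S, #|I| == #|S|.+1 & c @: S == [set~ i0]].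
pose room (S : {set X}) := dom S && (#|S| == #|I|).
have : \sum_(S | door S) #|[set x | (x \notin S) && dom (x |: S)]| =
       \sum_(S | room S) #|[set x in S | c @: (S :\ x) == [set~ i0]]|.
  under eq_bigr do rewrite -sum1dep_card.
  under [RHS]eq_bigr do rewrite -sum1dep_card.
  rewrite (exchange_big_dep xpredT) //= [RHS](exchange_big_dep xpredT) //=.
  apply: eq_bigr => x _.
  (* For a fixed vertex [x], adding [x] to a door and deleting [x] from a room are inverse to each
     other. *)
  rewrite [RHS](reindex_onto (fun S => x |: S) (fun S => S :\ x)) /=; last first.
    by move=> S /and3P[_ xS _]; rewrite setD1K.
  apply: eq_bigl => S; rewrite /door /room setU11 /=.
  have [xS|xS] := boolP (x \in S).
    rewrite !andbF; apply/esym/negbTE.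
    by apply/negP => /andP[_ /eqP SE]; move: xS; rewrite -SE !inE eqxx.
  rewrite setU1K // eqxx cardsU1 xS add1n eq_sym andbT /=.
  have [dxS|] := boolP (dom (x |: S)); last by rewrite !andbF.
  by rewrite (domS _ _ (subsetUr _ _) dxS) andbT.
move/(congr1 odd); rewrite !(big_morph odd oddD (erefl : odd 0 = false)).
rewrite (bigD1 S0) /=; last by rewrite /door dS0 cS0 cS0B !eqxx.
rewrite oddS // eqxx big1 => [|S /andP[/and3P[dS /eqP cS /eqP cSB] nS]]; last first.
  by rewrite oddS // (negbTE nS).
rewrite big1 // => S /andP[dS cS]; rewrite odd_card_doors ?(eqP cS) //.
apply: contraNF none => cST; apply/existsP; exists S; exact/and3P.
Qed.

Theorem scarf (T I : finType) (v : I -> T -> nat) (c : T -> I) (t0 : T) :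
  exists S : {set T}, forall y, exists2 i, i \in c @: S &
    forall x, x \in S -> v i y <= v i x.
Proof.
(* Ties of [v i] are broken by [enum_rank], since rooms and doors need injective orders; weak
   inequalities for [w] carry over to [v]. *)
pose w i x := v i x * #|T| + enum_rank x.
have wlt i x y : v i x < v i y -> w i x < w i y.
  move=> xy; rewrite /w (@leq_trans ((v i x).+1 * #|T|)) //.
    by rewrite mulSn addnC ltn_add2r.
  by rewrite (leq_trans _ (leq_addr _ _)) // leq_mul2r xy orbT.
have w_v i x y : w i x <= w i y -> v i x <= v i y.
  by apply: contraTT; rewrite -!ltnNge; apply: wlt.
have w_inj i : injective (w i).
  move=> x y wxy; have vxy : v i x = v i y.
    by apply/eqP; rewrite eqn_leq !w_v // wxy.
  by move: wxy; rewrite /w vxy => /addnI /val_inj /enum_rank_inj.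
(* Following Scarf, each order i is extended to T + I: the slack element inr i
   becomes its least element and the other ones lie above T. A subset S of T
   that is dominant with respect to the orders in C becomes S together with the
   slack elements outside C, and the set S0 of all slack elements but inr i0 is
   the only door with an odd number of rooms. *)
pose M := (\sum_i \sum_x w i x).+1.
have wM i x : (w i x).+1 <= M.
  by rewrite ltnS (bigD1 i) //= (bigD1 x) //= -addnA leq_addr.
pose i0 := c t0.
pose u i (z : T + I) := match z with
  | inl x => (w i x).+1
  | inr j => if j == i then 0 else (M + enum_rank j).+1 end.
have uinj i : injective (u i).
  move=> [x|j] [y|k] //=.
  - by move=> [/w_inj ->].
  - case: ifP => // _ [] wE; have := wM i x.
    by rewrite wE ltnNge leq_addr.
  - case: ifP => // _ [] wE; have := wM i y.
    by rewrite -wE ltnNge leq_addr.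
  - have [->|_] := eqVneq j i; have [->|_] := eqVneq k i => //.
    by move=> [/addnI /val_inj /enum_rank_inj ->].
pose d (z : T + I) := match z with inl x => c x | inr j => j end.
pose S0 : {set T + I} := inr @: [set~ i0].
have S0inr j : (inr j \in S0) = (j != i0).
  by rewrite mem_imset ?inE // => ? ? [].
have S0inl x : (inl x \in S0) = false by apply/negbTE/imsetP => -[].
have domS0 : dominant u S0.
  apply/dominantP => -[y|j]; last by exists j => z _; rewrite /= eqxx.
  exists i0 => -[x|j]; rewrite ?S0inl // S0inr /= => /negbTE ->.
  by rewrite ltnS (leq_trans _ (leq_addr _ _)) // ltnW.
have cS0 : #|I| = #|S0|.+1.
  rewrite card_imset => [|? ? [] //]; rewrite cardsC1 prednK //.
  by apply/card_gt0P; exists i0.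
have dS0 : d @: S0 = [set~ i0].
  by rewrite -imset_comp (eq_imset _ (_ : d \o inr =1 id)) // imset_id.
have [S dS cS dSB|R [dR cR cRT]] := sperner_parity (@dominantS _ _ u) domS0 cS0 dS0.
  have [->|nS] := eqVneq S S0.
    (* The only room over [S0] adds the [w i0]-greatest element of [T]. Adding [inr i0] instead
       would put the least element of every order into the set, and [inl t0] would exceed all of
       them. *)
    have [t _ maxt] := arg_maxnP (fun x => w i0 x) (erefl : xpredT t0).
    have {}maxt x : w i0 x <= w i0 t by exact: maxt.
    rewrite (_ : [set x | _] = [set inl t]) ?cards1 //.
    apply/setP => -[x|j]; rewrite !inE ?S0inl ?S0inr /=; last first.
      apply/negbTE; rewrite negb_and negbK -implybE; apply/implyP => ji0.
      apply/negP => /dominantP/(_ (inl t0))[i /(_ (inr i))].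
      rewrite /= eqxx !inE S0inr ltn0; have [->|_] := eqVneq i i0.
        by rewrite (eqP ji0) eqxx => /(_ isT).
      by rewrite orbT => /(_ isT).
    apply/idP/eqP => [/dominantP/(_ (inl t))[i Hi]|[->]].
      have ii0 : i = i0.
        apply/eqP/negPn/negP => nii0.
        by have := Hi (inr i); rewrite !inE S0inr nii0 orbT /= eqxx ltn0 => /(_ isT).
      have := Hi (inl x); rewrite setU11 ii0 /= ltnS => /(_ isT) tx.
      by congr inl; apply: (w_inj i0); apply/eqP; rewrite eqn_leq tx maxt.
    apply/dominantP => -[y|j]; last by exists j => z _; rewrite /= eqxx.
    exists i0 => -[z|j]; rewrite !inE ?S0inl ?S0inr.
      by rewrite orbF => /eqP[->]; rewrite ltnS maxt.
    by move=> /= /negbTE ->; rewrite ltnS (leq_trans (ltnW (wM i0 y))) // leq_addr.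
  (* If a door contains some [inl x], then [inr k] is a candidate for order [k], as it exceeds
     [inl x] in every other order. A door made of slack elements only is [S0], by its colours. *)
  have [/existsP[x xS]|nx] := boolP [exists x, inl x \in S].
    rewrite (card_room_of_door uinj dS cS xS) // => m k mS; exists (inr k) => l nlk.
    have [_ /(_ _ xS) /= mlx] := mS l.
    rewrite (leq_ltn_trans mlx) //= eq_sym (negbTE nlk) ltnS.
    by rewrite (leq_trans (wM l x)) // leq_addr.
  case/eqP: nS; apply/setP => -[x|j].
    by rewrite S0inl; apply: contraNF nx => xS; apply/existsP; exists x.
  have := in_set1 i0 j; rewrite S0inr -[j != i0]in_setC1 -dSB => _.
  apply/idP/imsetP => [jS|[[x|k] zS] //= ->]; first by exists (inr j).
    by case/existsP: nx; exists x.
  by [].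
exists [set x | inl x \in R] => y.
have /dominantP/(_ (inl y))[i Hi] := dR.
(* The slack element of a witnessing order is not in [R], so the colour [i] must come from an
   element of [T]. *)
have iR : inr i \notin R by apply/negP => /Hi; rewrite /= eqxx.
have /imsetP[[x|j] zR iE] : i \in d @: R by rewrite cRT inE.
  exists i => [|z]; first by apply/imsetP; exists x; rewrite ?inE.
  by rewrite inE => /Hi /=; rewrite ltnS; apply: w_v.
by move: iR; rewrite iE zR.
Qed.

(** The orders are the coordinates on the grid points of sum [N]. Let [g] be the coordinatewise
    minimum over [S] at the colours of [S] and 0 elsewhere. Dominance makes the sum of [g] exceed
    [N] minus the number of colours, so a point of [S] exceeds [g] by at most [n] in total. *)
Lemma scarf_grid (n N : nat) (c : {ffun 'I_n -> 'I_N.+1} -> 'I_n) :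
  exists S : {set {ffun 'I_n -> 'I_N.+1}},
    [/\ S != finset.set0,
      forall x, x \in S -> \sum_i x i = N :> nat,
      forall x i, x \in S -> i \notin c @: S -> x i <= n
    & forall x y i, x \in S -> y \in S -> x i <= y i + n].
Proof.
pose T := {x : {ffun 'I_n -> 'I_N.+1} | \sum_i x i == N :> nat}.
have gridT (f : 'I_n -> nat) : \sum_i f i = N ->
    exists t : T, forall i, val t i = f i :> nat.
  move=> fN; have fle i : f i < N.+1 by rewrite ltnS -fN (bigD1 i) //= leq_addr.
  pose x := [ffun i => Ordinal (fle i)].
  have xN : \sum_i x i == N :> nat.
    by rewrite -[X in _ == X]fN; apply/eqP; apply: eq_bigr => i _; rewrite ffunE.
  by exists (exist _ x xN) => i; rewrite ffunE.
have gridS (f : 'I_n -> nat) (j : 'I_n) : \sum_i f i <= N ->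
    exists t : T, forall i, f i <= val t i.
  move=> fN; have [|t tE] := gridT (fun i => f i + (i == j) * (N - \sum_i f i)).
    rewrite big_split -big_distrl /= [X in _ + X * _](bigD1 j) //= eqxx.
    rewrite (big1 _ (fun i => i != j)) => [|i /negbTE -> //].
    by rewrite addn0 mul1n subnKC.
  by exists t => i; rewrite tE leq_addr.
have j0 : 'I_n by exact: (c [ffun=> ord0]).
have [|t0 _] := gridS (fun=> 0) j0; first by rewrite big1.
have [S HS] := scarf (fun i (t : T) => val (val t i)) (fun t => c (val t)) t0.
have [s0 s0S] : exists s0, s0 \in S.
  by have [i /imsetP[s sS _] _] := HS t0; exists s.
have [m mS] := min_selector_exists (fun i (t : T) => val (val t i)) s0S.
pose C := (fun t : T => c (val t)) @: S.
pose g i := if i \in C then val (val (m i) i) else 0.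
have gle t i : t \in S -> g i <= val t i.
  by move=> tS; rewrite /g; case: ifP => // _; have [_] := mS i; apply.
(* Otherwise some grid point exceeds g on all of C, against dominance. *)
have Ng : N < \sum_i (g i + (i \in C)).
  rewrite ltnNge; apply/negP => /(gridS _ j0) [t tle].
  have [i iC it] := HS t; have [miS _] := mS i.
  have := leq_trans (tle i) (it _ miS).
  by rewrite /g iC addn1 ltnn.
have sumS t : t \in S -> \sum_i (val t i - g i) <= n.
  move=> tS; rewrite -(leq_add2r (\sum_i g i)) -big_split /=.
  rewrite (eq_bigr (fun i => val (val t i))) => [|i _]; last by rewrite subnK // gle.
  rewrite (eqP (valP t)) (leq_trans (ltnW Ng)) // big_split /= addnC leq_add2r.
  by rewrite -[leqRHS]card_ord -sum1_card leq_sum // => i _; case: (_ \in _).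
have close t i : t \in S -> val t i <= g i + n.
  move=> tS; rewrite -leq_subLR (leq_trans _ (sumS t tS)) //.
  by rewrite (bigD1 i) //= leq_addr.
have CE : c @: (val @: S) = C by rewrite -imset_comp.
exists (val @: S); split=> [|_ /imsetP[t _ ->]|_ i /imsetP[t tS ->]
  |_ _ i /imsetP[t tS ->] /imsetP[t' t'S ->]].
- by apply/set0Pn; exists (val s0); apply: imset_f.
- exact/eqP/(valP t).
- by rewrite CE => iC; have := close t i tS; rewrite /g (negbTE iC).
- by rewrite (leq_trans (close t i tS)) // leq_add2r gle.
Qed.

End Combinatorics.

Local Open Scope classical_set_scope.
Local Open Scope ring_scope.

(** * The dual KKM lemma *)

Definition simplex (R : realType) n : set 'rV[R]_n :=
  [set r | (forall i, 0 <= r ord0 i) /\ \sum_i r ord0 i = 1].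

Lemma continuous_combination (R : realType) (V : normedModType R) n (y : 'I_n -> V) :
  continuous (fun r : 'rV[R]_n => \sum_i r ord0 i *: y i).
Proof.
apply: continuous_big => [|i _ r]; first exact: add_continuous.
exact: (cvgZr_tmp (@coord_continuous R 1 n ord0 i r)).
Qed.

Lemma compact_simplex (R : realType) n : compact (@simplex R n).
Proof.
have cube : compact [set r : 'rV[R]_n | forall i, `[0, 1]%classic (r ord0 i)].
  have := @rV_compact R n (fun=> `[0, 1]%classic) (fun=> @segment_compact R 0 1); exact.
apply: (subclosed_compact _ cube) => [|r [r0 r1] i /=]; last first.
  rewrite in_itv /= r0 /= -r1 (bigD1 i) //= lerDl.
  exact: sumr_ge0.
(* The coordinate sum is written as a combination of vectors [1 : R^o] so that
   [continuous_combination] applies. *)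
have -> : @simplex R n = \bigcap_i [set r : 'rV[R]_n | 0 <= r ord0 i] `&`
    [set r | \sum_i r ord0 i *: (1 : R^o) = 1].
  have sumE (r : 'rV[R]_n) : \sum_i r ord0 i *: (1 : R^o) = \sum_i r ord0 i.
    by apply: eq_bigr => i _; rewrite -[LHS]/(r ord0 i * 1) mulr1.
  apply/seteqP; split=> r /= [r0]; rewrite ?sumE => r1; split; rewrite ?sumE // => i.
    by move=> _; apply: r0.
  exact: r0.
apply: closedI.
  apply: closed_bigI => i _.
  apply: (@closed_comp _ _ (fun r : 'rV[R]_n => r ord0 i) [set x : R | 0 <= x]).
    by move=> r _; exact: coord_continuous.
  exact: closed_ge.
apply: (@closed_comp _ _ (fun r : 'rV[R]_n => \sum_i r ord0 i *: (1 : R^o))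
  [set x : R | x = 1]).
  by move=> r _; exact: continuous_combination.
exact: closed_eq.
Qed.

(** Each grid point is coloured by the index of a set [G i] that contains it. In the set given by
    [scarf_grid], a coordinate above [e] belongs to a colour that occurs, hence to a nearby point of
    [G i]. *)
Lemma kkm_dual_approx (R : realType) n (G : 'I_n -> set 'rV[R]_n) (e : R) :
  (0 < n)%N -> 0 < e -> @simplex R n `<=` \bigcup_i G i ->
  exists2 r, simplex r & forall i, r ord0 i > e ->
    exists s, [/\ simplex s, G i s & ball r e s].
Proof.
move=> n0 e0 cov.
(* After division by [N], the bound [n] of [scarf_grid] becomes less than [e]. *)
have [N Ne] : exists N : nat, n%:R / e < N%:R.
  by exists (Num.truncn (n%:R / e)).+1; rewrite truncnS_gt.
have N0 : 0 < N%:R :> R by rewrite (le_lt_trans _ Ne) // divr_ge0 // ltW.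
have nNe : n%:R / N%:R < e by rewrite ltr_pdivrMr // mulrC -ltr_pdivrMr.
pose pt (x : {ffun 'I_n -> 'I_N.+1}) : 'rV[R]_n := \row_i ((x i)%:R / N%:R).
have ptS (x : {ffun 'I_n -> 'I_N.+1}) : (\sum_i x i = N)%N -> simplex (pt x).
  move=> xN; split=> [i|]; first by rewrite mxE divr_ge0.
  under eq_bigr do rewrite mxE.
  by rewrite -mulr_suml -natr_sum xN divff // gt_eqF.
have [c cG] : {c : {ffun 'I_n -> 'I_N.+1} -> 'I_n &
    forall x : {ffun 'I_n -> 'I_N.+1}, (\sum_i x i = N)%N -> G (c x) (pt x)}.
  apply: (@choice _ _ (fun (x : {ffun 'I_n -> 'I_N.+1}) i =>
    (\sum_i x i = N)%N -> G i (pt x))) => x.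
  have [xN|] := pselect (\sum_i x i = N)%N; last by exists (Ordinal n0).
  by have [i _ Gi] := cov _ (ptS x xN); exists i.
have [S [/set0Pn[x xS] SN Sout Sclose]] := scarf_grid c.
exists (pt x); first exact/ptS/SN.
move=> i; rewrite mxE => exi.
have : i \in [set c y | y in S]%SET.
  apply: contraTT exi => /(Sout x i xS) xin; rewrite -leNgt.
  by rewrite (le_trans _ (ltW nNe)) // ler_pM2r ?invr_gt0 // ler_nat.
case/imsetP => y yS ->; exists (pt y); split.
- exact/ptS/SN.
- exact/cG/SN.
- split=> // k j; rewrite [k]ord1 !mxE /ball /= -mulrBl normrM.
  rewrite normfV (ger0_norm (ltW N0)).
  rewrite (le_lt_trans _ nNe) // ler_pM2r ?invr_gt0 // ler_norml lerNl opprB !lerBlDl.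
  by rewrite -!natrD !ler_nat !Sclose.
Qed.

Theorem kkm_dual (R : realType) n (G : 'I_n -> set 'rV[R]_n) :
  (0 < n)%N -> (forall i, closed (G i)) -> @simplex R n `<=` \bigcup_i G i ->
  exists2 r, simplex r & forall i, r ord0 i > 0 -> G i r.
Proof.
move=> n0 clG cov.
have eN (N : nat) : 0 < N.+1%:R^-1 :> R by rewrite invr_gt0.
pose P (N : nat) (r : 'rV[R]_n) := simplex r /\ forall i, N.+1%:R^-1 < r ord0 i ->
    exists s, [/\ simplex s, G i s & ball r N.+1%:R^-1 s].
have [rho rhoP] : {rho : nat -> 'rV[R]_n & forall N, P N (rho N)}.
  apply: (@choice _ _ P) => N.
  by have [r rS rP] := kkm_dual_approx n0 (eN N) cov; exists r.
have [r [rS rcl]] : @simplex R n `&` cluster (rho @ \oo) !=set0.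
  apply: compact_simplex; exists 0%N => // N _ /=; exact: (rhoP N).1.
exists r => // i ri0; apply: (clG i) => B /nbhs_ballP[d /= d0 dB].
(* The first bound keeps [s] in the ball of radius [d] around [r]; the second keeps coordinate [i]
   of [rho N] above the tolerance. *)
pose e := Num.min (d / 2) (r ord0 i / 2).
have e0 : 0 < e by rewrite lt_min !divr_gt0.
have near_e : \forall N \near \oo, N.+1%:R^-1 < e.
  exact: near_infty_natSinv_lt (PosNum e0).
have [] := rcl [set rho N | N in [set N | N.+1%:R^-1 < e]] (ball r e).
- by apply: filterS near_e => N Ne; exists N.
- exact: nbhsx_ballx.
move=> _ [[N /= Ne <-] rrho].
have rhoi : N.+1%:R^-1 < rho N ord0 i.
  rewrite (lt_le_trans Ne) //.
  have : `|r ord0 i - rho N ord0 i| < e by exact: rrho.2.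
  rewrite ltr_norml => /andP[_]; rewrite ltrBlDr -ltrBlDl => /ltW; apply: le_trans.
  by rewrite lerBrDr [leRHS]splitr lerD // ge_min lexx orbT.
have [s [sS Gs sball]] := (rhoP N).2 i rhoi.
exists s; split=> //; apply: dB; apply: (le_ball _ (ball_triangle rrho sball)).
by rewrite [d]splitr lerD // ?(le_trans (ltW Ne)) // ge_min lexx.
Qed.

(** * Kakutani's theorem *)

Lemma convex_setP (R : realType) (V : lmodType R) (A : set V) :
  convex_set A <-> forall (x y : V) (t : R), A x -> A y -> 0 <= t <= 1 ->
    A (t *: x + (1 - t) *: y).
Proof.
split=> [cA x y t Ax Ay t01|cA x y t /set_mem Ax /set_mem Ay].
  have [t0 t1] := andP t01.
  by have := cA x y (Itv01 t0 t1) (mem_set Ax) (mem_set Ay) => /set_mem.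
by apply/mem_set/cA => //; rewrite ge0 le1.
Qed.

(** By induction on a list of indices, a partial sum of positive weight is that weight times a point
    of [A]; indices of weight zero are skipped. *)
Lemma convex_combination (R : realType) (V : lmodType R) (A : set V) n
    (r : 'rV[R]_n) (y : 'I_n -> V) :
  convex_set A -> simplex r -> (forall i, r ord0 i > 0 -> A (y i)) ->
  A (\sum_i r ord0 i *: y i).
Proof.
move=> /convex_setP cA [r0 r1] yA.
suff {r1} H (l : seq 'I_n) : \sum_(i <- l) r ord0 i > 0 ->
    exists2 a, A a & \sum_(i <- l) r ord0 i *: y i = (\sum_(i <- l) r ord0 i) *: a.
  by have [|a Aa ->] := H (index_enum _); rewrite r1 ?ltr01 ?scale1r.
elim: l => [|i l IHl]; first by rewrite big_nil ltxx.
rewrite !big_cons => sum_gt0.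
have [ri0|ri_neq0] := eqVneq (r ord0 i) 0.
  by move: sum_gt0; rewrite ri0 scale0r !add0r; exact: IHl.
have ri0 : 0 < r ord0 i by rewrite lt_neqAle eq_sym ri_neq0 r0.
have [l0|l_neq0] := eqVneq (\sum_(j <- l) r ord0 j) 0.
  exists (y i); first exact: yA.
  rewrite l0 addr0 big1_seq ?addr0 // => j /= jl.
  have /eqP := l0; rewrite psumr_eq0 // => /allP/(_ j jl) /eqP ->.
  by rewrite scale0r.
have l0 : 0 < \sum_(j <- l) r ord0 j by rewrite lt_neqAle eq_sym l_neq0 sumr_ge0.
have [a Aa ->] := IHl l0; set s := \sum_(j <- l) _ in l0 *.
have s0 : 0 < r ord0 i + s by rewrite addr_gt0.
exists (r ord0 i / (r ord0 i + s) *: y i + (1 - r ord0 i / (r ord0 i + s)) *: a).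
  apply: cA => //; first exact: yA.
  by rewrite divr_ge0 ?(ltW ri0) ?(ltW s0) //= ler_pdivrMr // mul1r lerDl ltW.
rewrite scalerDr !scalerA; congr (_ *: _ + _ *: _).
  by rewrite mulrC divfK // gt_eqF.
by rewrite mulrBr mulr1 mulrC divfK ?gt_eqF // [_ + s]addrC addrK.
Qed.

(** Quantifying over [W] expresses that [z] lies in the convex hull of the values [F x] at points
    [x] of [K] within [e] of [z]. *)
Lemma kakutani_approx (R : realType) (V : normedModType R) (K : set V)
    (F : V -> set V) (e : R) :
  compact K -> convex_set K -> K !=set0 ->
  (forall x, K x -> F x !=set0) -> (forall x, K x -> F x `<=` K) -> 0 < e ->
  exists2 z, K z & forall W : set V, convex_set W ->
    (forall x, K x -> `|z - x| <= e -> F x `<=` W) -> W z.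
Proof.
move=> cK convK [k0 Kk0] Fne FK e0.
have := cK; rewrite compact_cover => /(_ _ K (fun x => ball x e)) [||D DK Dcov].
- by move=> x _; exact: ball_open.
- by move=> x Kx; exists x => //; exact: ballxx.
pose n := size (enum_fset D); pose x (i : 'I_n) := nth k0 (enum_fset D) i.
have Kx i : K (x i).
  by apply: set_mem; apply: DK; apply: mem_nth.
have n0 : (0 < n)%N.
  by have [d dD _] := Dcov _ Kk0; rewrite /n -has_predT; apply/hasP; exists d.
have [y yF] : {y : 'I_n -> V & forall i, F (x i) (y i)}.
  by apply: (@choice _ _ (fun i y => F (x i) y)) => i; exact/Fne/Kx.
pose z (r : 'rV[R]_n) := \sum_i r ord0 i *: y i.
have Kz r : simplex r -> K (z r).
  by move=> rS; apply: convex_combination => // i _; exact: (FK _ (Kx i)).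
have [i|r rS|r rS rP] := @kkm_dual R n (fun i => [set r | `|z r - x i| <= e]) n0.
- apply: (@closed_comp _ _ (fun r => `|z r - x i|) [set t | t <= e]).
  by move=> r _; exact: (cvg_norm (cvgB (@continuous_combination _ _ _ y r) (cvg_cst _))).
  exact: closed_le.
- have [d dD zd] := Dcov _ (Kz r rS).
  have di : (index d (enum_fset D) < n)%N by rewrite index_mem.
  exists (Ordinal di) => //=; rewrite /x /= nth_index //.
  by move: zd; rewrite -ball_normE /= distrC => /ltW.
exists (z r); first exact: Kz.
move=> W convW HW; apply: convex_combination => // i ri.
by apply: (HW (x i)) => //; exact: rP.
Qed.

(* The separation hypothesis replaces convexity of the values and upper
   hemicontinuity of F, from which it follows by a neighbourhood of F z. *)
Theorem kakutani (R : realType) (V : normedModType R) (K : set V) (F : V -> set V) :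
  compact K -> convex_set K -> K !=set0 ->
  (forall x, K x -> F x !=set0) -> (forall x, K x -> F x `<=` K) ->
  (forall z, K z -> ~ F z z -> exists W : set V, [/\ convex_set W, ~ closure W z &
     \forall x \near within K (nbhs z), F x `<=` W]) ->
  exists2 z, K z & F z z.
Proof.
move=> cK convK Kne Fne FK sep.
have eN (N : nat) : 0 < N.+1%:R^-1 :> R by rewrite invr_gt0.
pose P (N : nat) (z : V) := K z /\ forall W : set V, convex_set W ->
    (forall x, K x -> `|z - x| <= N.+1%:R^-1 -> F x `<=` W) -> W z.
have [zs zsP] : {zs : nat -> V & forall N, P N (zs N)}.
  apply: (@choice _ _ P) => N.
  by have [z Kz zP] := kakutani_approx cK convK Kne Fne FK (eN N); exists z.
have [z [Kz zcl]] : K `&` cluster (zs @ \oo) !=set0.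
  by apply: cK; exists 0%N => // N _ /=; exact: (zsP N).1.
exists z => //; apply: contrapT => /(sep z Kz)[W [convW nWz FW]].
have [B Bz BW] : exists2 B, nbhs z B & forall x, B x -> ~ W x.
  apply: contrapT => nB; apply: nWz => B Bz; apply: contrapT => WB0.
  by apply: nB; exists B => // x Bx Wx; apply: WB0; exists x.
have : nbhs z (B `&` [set x | K x -> F x `<=` W]) by exact: filterI.
move=> /nbhs_ballP[d /= d0 dB].
(* Half of [d] bounds the distance from [z] to [zs N], the other half that from [zs N] to [x]; hence
   [F x] lies in [W] and so does [zs N], although [B] avoids [W]. *)
have d20 : 0 < d / 2 by rewrite divr_gt0.
have near_d : \forall N \near \oo, N.+1%:R^-1 < d / 2.
  exact: near_infty_natSinv_lt (PosNum d20).
have [] := zcl [set zs N | N in [set N | N.+1%:R^-1 < d / 2]] (ball z (d / 2)).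
- by apply: filterS near_d => N Nd; exists N.
- exact: nbhsx_ballx.
move=> _ [[N /= Nd <-] zzN].
have [Bz' _] : B (zs N) /\ (K (zs N) -> F (zs N) `<=` W).
  by apply: dB; apply: le_ball zzN; rewrite ler_pdivrMr // mulr_natr mulr2n lerDl ltW.
apply: (BW _ Bz'); apply: (zsP N).2 => // x Kx xN.
have [_] : B x /\ (K x -> F x `<=` W); last by apply.
apply: dB; rewrite [d]splitr; apply: ball_triangle zzN _.
by rewrite -ball_normE /=; exact: le_lt_trans xN Nd.
Qed.

(** * Best responses *)

Lemma near_within_rect (R : realType) (U V : normedModType R) (A : set U) (B : set V)
    (f : U * V -> R) (u : U) (v : V) (e : R) :
  {within A `*` B, continuous f} -> A u -> B v -> 0 < e ->
  \forall x \near u & y \near v, A x -> B y -> `|f (u, v) - f (x, y)| < e.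
Proof.
move=> /subspace_continuousP cf Au Bv e0.
have /cvgrPdist_lt/(_ e e0) := cf (u, v) (conj Au Bv).
case=> -[/= P Q] [Pu Qv] PQ; exists (P, Q) => //= -[x y] [/= Px Qy] Ax By.
by apply: (PQ (x, y)).
Qed.

(** This is uniform convergence of the sections on [A]: near each point of [A] a rectangle works,
    and compactness in its near-covering form glues the rectangles. *)
Lemma near_uniform_section (R : realType) (U V : normedModType R) (A : set U) (B : set V)
    (f : U * V -> R) (v : V) (e : R) :
  compact A -> {within A `*` B, continuous f} -> B v -> 0 < e ->
  \forall y \near v, B y -> forall x, A x -> `|f (x, v) - f (x, y)| < e.
Proof.
move=> /compact_near_coveringP/near_covering_withinP cA cf Bv e0.
have := cA V (within B (nbhs v)) (fun y x => `|f (x, v) - f (x, y)| < e) _; apply=> u Au.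
have e20 : 0 < e / 2 by rewrite divr_gt0.
have [[P Q] /= [Pu Qv] PQ] := near_within_rect cf Au Bv e20.
exists (P, B `&` Q) => /=; first by split=> //; apply: filterS Qv => w Qw Bw.
move=> [x y] [/= Px [By Qy]] Ax.
rewrite (le_lt_trans (ler_distD (f (u, v)) _ _)) // [e]splitr ltrD //.
  by rewrite distrC; apply: (PQ (x, v)) => //; split=> //=; exact: nbhs_singleton.
exact: (PQ (x, y)).
Qed.

Lemma within_section (R : realType) (U V : normedModType R) (A : set U) (B : set V)
    (f : U * V -> R) (v : V) :
  {within A `*` B, continuous f} -> B v -> {within A, continuous (fun x => f (x, v))}.
Proof.
move=> cf Bv; apply/subspace_continuousP => u Au; apply/cvgrPdist_lt => e e0.
have [[P Q] /= [Pu Qv] PQ] := near_within_rect cf Au Bv e0.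
apply: filterS Pu => x Px Ax; apply: (PQ (x, v)) => //.
by split=> //=; exact: nbhs_singleton.
Qed.

Lemma argmin_nonempty (R : realType) (U V : normedModType R) (A : set U) (B : set V)
    (f : U * V -> R) (v : V) :
  A !=set0 -> compact A -> {within A `*` B, continuous f} -> B v ->
  argmin A (fun x => f (x, v)) !=set0.
Proof.
move=> A0 cA cf Bv.
have [u /set_mem Au uP] := compact_EVT_min A0 cA (within_section cf Bv).
by exists u; split=> // x Ax; apply/uP/mem_set.
Qed.

(** [W] is a sublevel set of the section at [v], at a level halfway between the value at [u] and a
    smaller value at some [w]. It is convex because the section is, and minimisers for nearby [y]
    fall into it by uniform convergence. *)
Lemma argmin_separation (R : realType) (U V : normedModType R) (A : set U) (B : set V)
    (f : U * V -> R) (u : U) (v : V) :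
  compact A -> convex_set A -> {within A `*` B, continuous f} ->
  convex_function A (fun x => f (x, v)) -> A u -> B v ->
  ~ argmin A (fun x => f (x, v)) u ->
  exists W : set U, [/\ convex_set W, ~ closure W u &
    \forall y \near within B (nbhs v), argmin A (fun x => f (x, y)) `<=` W].
Proof.
move=> cA /convex_setP convA cf convf Au Bv nu.
have [w Aw fwu] : exists2 w, A w & f (w, v) < f (u, v).
  apply: contrapT => nw; apply: nu; split=> // x Ax; rewrite leNgt; apply/negP => fx.
  by apply: nw; exists x.
(* Passing between [y] and [v] costs [d] at the minimiser and [d] at [w], hence the level [2 * d];
   near [u] the values stay above [3 * d], both relative to [f (w, v)]. *)
pose d := (f (u, v) - f (w, v)) / 4.
have d0 : 0 < d by rewrite divr_gt0 // subr_gt0.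
pose W := [set x | A x /\ f (x, v) <= f (w, v) + 2 * d].
have dE : f (u, v) = f (w, v) + 4 * d by rewrite /d; field.
exists W; split.
- apply/convex_setP => x y t [Ax fx] [Ay fy] t01; split; first exact: convA.
  have [t0 t1] := andP t01.
  have := convf (Itv01 t0 t1) x y (mem_set Ax) (mem_set Ay).
  rewrite convRE /= => /le_trans; apply.
  have -> : f (w, v) + 2 * d = t * (f (w, v) + 2 * d) + (1 - t) * (f (w, v) + 2 * d).
    by ring.
  by rewrite lerD // ler_wpM2l // subr_ge0.
- have := within_section cf Bv => /subspace_continuousP/(_ u Au)/cvgrPdist_lt/(_ d d0) ud.
  move=> /(_ _ ud)[x [[Ax fx] /(_ Ax)]].
  rewrite /from_subspace /= ltr_norml dE => /andP[_]; lra.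
- have := near_uniform_section cA cf Bv d0; apply: filterS.
  move=> y yP By x [Ax xmin]; split=> //.
  have := yP By x Ax; have := yP By w Aw; have := xmin w Aw.
  rewrite !ltr_norml => ? /andP[? ?] /andP[? ?]; lra.
Qed.

(** [W] is the open [d / 2]-neighbourhood of [F u], where the ball of radius [d] around [v] misses
    [F u]. It inherits convexity from [F u], and the remaining [d / 2] keeps [v] out of its
    closure. *)
Lemma uhc_separation (R : realType) (U V : normedModType R) (A : set U)
    (F : U -> set V) (u : U) (v : V) :
  A u -> upper_hemicontinuous_on A F -> convex_set (F u) -> compact (F u) -> ~ F u v ->
  exists W : set V, [/\ convex_set W, ~ closure W v &
    \forall x \near within A (nbhs u), F x `<=` W].
Proof.
move=> Au uhc /convex_setP convF cF nFv.
have clF : closed (F u) by apply: compact_closed => //; exact: norm_hausdorff.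
have /nbhs_ballP[d /= d0 dF] : nbhs v (~` F u).
  by apply: open_nbhs_nbhs; split=> //; exact: closed_openC.
have d20 : 0 < d / 2 by rewrite divr_gt0.
pose W := \bigcup_(w in F u) ball w (d / 2).
exists W; split.
- apply/convex_setP => x y t [a Fa ax] [b Fb yb] t01.
  exists (t *: a + (1 - t) *: b); first exact: convF.
  move: ax yb t01; rewrite -!ball_normE /= => ax yb /andP[t0 t1].
  rewrite opprD addrACA -!scalerBr (le_lt_trans (ler_normD _ _)) // !normrZ.
  rewrite (ger0_norm t0) ger0_norm ?subr_ge0 //.
  apply: (@le_lt_trans _ _ (Num.max `|a - x| `|b - y|)); last by rewrite gt_max ax yb.
  have : `|a - x| <= Num.max `|a - x| `|b - y| by rewrite le_max lexx.
  have : `|b - y| <= Num.max `|a - x| `|b - y| by rewrite le_max lexx orbT.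
  nra.
- move=> /(_ _ (nbhsx_ballx v _ d20))[x [[w Fw wx] vx]].
  apply: (dF w) => //; rewrite [d]splitr; apply: ball_triangle vx _.
  exact: ball_sym.
- apply: uhc => //; first by apply: bigcup_open => w _; exact: ball_open.
  by move=> w Fw; exists w => //; exact: ballxx.
Qed.

Theorem theorem1 (R : realType) (n1 n2 : nat)
    (X1 : set 'rV[R]_n1) (X2 : set 'rV[R]_n2)
    (hX1_nonempty : X1 !=set0) (hX1_convex : convex_set X1)
    (hX1_compact : compact X1)
    (hX2_nonempty : X2 !=set0) (hX2_convex : convex_set X2)
    (hX2_compact : compact X2)
    (J1 : 'rV[R]_n1 * 'rV[R]_n2 -> R)
    (hJ1_continuous : {within X1 `*` X2, continuous J1})
    (hJ1_convex : forall x2, X2 x2 ->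
       convex_function X1 (fun x1 => J1 (x1, x2)))
    (J2 : 'rV[R]_n1 * 'rV[R]_n2 -> R)
    (BR2 : 'rV[R]_n1 -> set 'rV[R]_n2)
    (hBR2 : is_best_response X1 X2 J2 BR2)
    (hBR2_sub : forall x1, X1 x1 -> BR2 x1 `<=` X2)
    (hBR2_nonempty : forall x1, X1 x1 -> BR2 x1 !=set0)
    (hBR2_convex : forall x1, X1 x1 -> convex_set (BR2 x1))
    (hBR2_compact : forall x1, X1 x1 -> compact (BR2 x1))
    (hBR2_uhc : upper_hemicontinuous_on X1 BR2) :
  exists x : 'rV[R]_n1 * 'rV[R]_n2, nash_equilibrium X1 X2 J1 BR2 x.
Proof.
(* The fixed points of [F] in [X1 * X2] are the Nash equilibria. *)
pose F (z : 'rV[R]_n1 * 'rV[R]_n2) := argmin X1 (fun x => J1 (x, z.2)) `*` BR2 z.1.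
suff [z Kz [Mz Bz]] : exists2 z, (X1 `*` X2) z & F z z by exists z.
have convX (A : set 'rV[R]_n1) (B : set 'rV[R]_n2) :
    convex_set A -> convex_set B -> convex_set (A `*` B).
  move=> /convex_setP cA /convex_setP cB; apply/convex_setP.
  by move=> x y t [Ax Bx] [Ay By] t01; split; [exact: cA|exact: cB].
apply: kakutani.
- exact: compact_setX.
- exact: convX.
- by have [[x X1x] [y X2y]] := (hX1_nonempty, hX2_nonempty); exists (x, y).
- move=> [x y] [/= X1x X2y].
  have [a Ma] := argmin_nonempty hX1_nonempty hX1_compact hJ1_continuous X2y.
  by have [b Bb] := hBR2_nonempty x X1x; exists (a, b).
- by move=> [x y] [/= X1x X2y] [a b] [[/= X1a _] Bb]; split=> //; exact: hBR2_sub Bb.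
move=> [x y] [/= X1x X2y] nF.
(* A point outside a product fails in one factor; a separating set for that factor, times the whole
   other space, separates the pair. *)
have [My|nMy] := pselect (argmin X1 (fun a => J1 (a, y)) x); last first.
  have [W [convW nWx MW]] := argmin_separation hX1_compact hX1_convex
    hJ1_continuous (hJ1_convex y X2y) X1x X2y nMy.
  exists (W `*` setT); split; first by apply: convX => //; apply/convex_setP.
    apply: contra_not nWx => WTxy B Bx.
    have [|[a b] [[/= Wa _] [/= Ba _]]] := WTxy (B `*` setT); last by exists a.
    by exists (B, setT) => //; split=> //; exact: filterT.
  exists (setT, [set b | X2 b -> argmin X1 (fun a => J1 (a, b)) `<=` W]).
    by split; [exact: filterT|].
  by move=> [a b] [_ /= bW] [/= _ X2b] [c d] [/= Mc _]; split=> //; exact: bW Mc.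
have nBy : ~ BR2 x y by move=> By; apply: nF.
have [W [convW nWy BW]] :=
  uhc_separation X1x hBR2_uhc (hBR2_convex x X1x) (hBR2_compact x X1x) nBy.
exists (setT `*` W); split; first by apply: convX => //; apply/convex_setP.
  apply: contra_not nWy => TWxy B By.
  have [|[a b] [[/= _ Wb] [/= _ Bb]]] := TWxy (setT `*` B); last by exists b.
  by exists (setT, B) => //; split=> //; exact: filterT.
exists ([set a | X1 a -> BR2 a `<=` W], setT).
  by split; [|exact: filterT].
by move=> [a b] [/= aW _] [/= X1a _] [c d] [/= _ Bd]; split=> //; exact: aW Bd.
Qed.
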